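(* Let $\Omega$ be a connected slice Cauchy domain of $\mathbb H$. Then $$\{f\in SH_L(\Omega):\mathcal Df=0\}=\{f\in SH_L(\Omega): f\equiv\alpha\ \text{for some }\alpha\in\mathbb H\}=\{f\in SH_R(\Omega): f\equiv\alpha\ \text{for some }\alpha\in\mathbb H\}=\{f\in SH_R(\Omega): f\mathcal D=0\}.$$
   Context: $\mathbb H$ denotes the quaternions, $\mathbb S$ the sphere of unit purely imaginary quaternions and $\mathbb C_J=\{u+Jv\}$. A set is axially symmetric if with $u+Iv$ it contains all $u+Jv$, $J\in\mathbb S$. A slice Cauchy domain is an axially symmetric open set $U$ such that for each $J\in\mathbb S$ the boundary of $U\cap\mathbb C_J$ is a finite union of nonintersecting piecewise $C^1$ Jordan curves. $SH_L(\Omega)$ (resp. $SH_R(\Omega)$) denotes the left (resp. right) slice hyperholomorphic functions on $\Omega$: $f(u+Jv)=\alpha(u,v)+J\beta(u,v)$ (resp. $\alpha+\beta J$) for all $J\in\mathbb S$, with $\alpha,\beta$ $\mathbb H$-valued differentiable, $\alpha(u,-v)=\alpha(u,v)$, $\beta(u,-v)=-\beta(u,v)$, $\partial_u\alpha-\partial_v\beta=0$, $\partial_v\alpha+\partial_u\beta=0$. $\mathcal Df=\partial_{q_0}f+\sum_{i=1}^3e_i\partial_{q_i}f$ and $f\mathcal D=\partial_{q_0}f+\sum_{i=1}^3\partial_{q_i}f\,e_i$. *)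

(* Defs.v *)
From HB Require Import structures.
From mathcomp Require Import all_boot all_order all_algebra.
From mathcomp Require Import all_classical all_reals all_analysis.
Set Implicit Arguments. Unset Strict Implicit. Unset Printing Implicit Defensive.
Import Order.TTheory GRing.Theory Num.Theory.
Import numFieldNormedType.Exports.
Local Open Scope classical_set_scope.
Local Open Scope ring_scope.

(* Quaternions over a real type R are represented as row vectors 'rV[R]_4,
   q = q_0 + q_1 e_1 + q_2 e_2 + q_3 e_3 (e_1=i, e_2=j, e_3=k), which carry
   the standard (Euclidean-type) normed/topological structure of R^4. *)
Notation quat R := 'rV[R]_4.

Section Quat.
Variable R : realType.

Definition qc (q : quat R) (i : nat) : R := q ord0 (inord i).

Definition qmk (a b c d : R) : quat R := \row_(i < 4) [:: a; b; c; d]`_i.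

Definition qmul (p q : quat R) : quat R :=
  let a1 := qc p 0 in let b1 := qc p 1 in let c1 := qc p 2 in let d1 := qc p 3 in
  let a2 := qc q 0 in let b2 := qc q 1 in let c2 := qc q 2 in let d2 := qc q 3 in
  qmk (a1*a2 - b1*b2 - c1*c2 - d1*d2)
      (a1*b2 + b1*a2 + c1*d2 - d1*c2)
      (a1*c2 - b1*d2 + c1*a2 + d1*b2)
      (a1*d2 + b1*c2 - c1*b2 + d1*a2).

Definition qe (i : nat) : quat R := \row_(j < 4) (j == i :> nat)%:R.

Definition qsphere : set (quat R) :=
  [set J | qc J 0 = 0 /\ qc J 1 ^+ 2 + qc J 2 ^+ 2 + qc J 3 ^+ 2 = 1].

Definition qslice (J : quat R) (p : R * R) : quat R :=
  p.1 *: qe 0 + p.2 *: J.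

Definition axially_symmetric (U : set (quat R)) : Prop :=
  forall (u v : R) (I J : quat R), qsphere I -> qsphere J ->
    U (qslice I (u, v)) -> U (qslice J (u, v)).

(* U ∩ C_J, viewed in R^2 through (u,v) |-> u + J v *)
Definition slice_set (U : set (quat R)) (J : quat R) : set (R * R) :=
  [set p | U (qslice J p)].

Definition boundary2 (A : set (R * R)) : set (R * R) :=
  closure A `\` interior A.

Definition C1_on_R (g : R -> R * R) : Prop :=
  (forall t, derivable g t 1) /\ continuous (fun t => 'D_1 g t).

Definition pw_C1_jordan_curve (g : R -> R * R) : Prop :=
  continuous g /\
  (forall t, g (t + 1) = g t) /\
  (forall s t, 0 <= s < 1 -> 0 <= t < 1 -> g s = g t -> s = t) /\
  exists (n : nat) (ts : nat -> R),
    ts 0%N = 0 /\ ts n = 1 /\ (forall k, (k < n)%N -> ts k < ts k.+1) /\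
    forall k, (k < n)%N -> exists gk : R -> R * R,
      C1_on_R gk /\ forall t, ts k <= t <= ts k.+1 -> gk t = g t.

Definition slice_Cauchy_domain (U : set (quat R)) : Prop :=
  axially_symmetric U /\ open U /\
  forall J, qsphere J ->
    exists (n : nat) (g : nat -> R -> R * R),
      (forall i, (i < n)%N -> pw_C1_jordan_curve (g i)) /\
      (forall i j, (i < n)%N -> (j < n)%N -> i <> j ->
          range (g i) `&` range (g j) = set0) /\
      boundary2 (slice_set U J) = \bigcup_(i in [set k | (k < n)%N]) range (g i).

Definition slice_dom (U : set (quat R)) : set (R * R) :=
  [set p | exists J, qsphere J /\ U (qslice J p)].

Definition stem_cond (U : set (quat R)) (a b : R * R -> quat R) : Prop :=
  forall p, slice_dom U p ->
    [/\ differentiable a p /\ differentiable b p,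
        a (p.1, - p.2) = a p, b (p.1, - p.2) = - b p,
        derive a p (1, 0) - derive b p (0, 1) = 0 &
        derive a p (0, 1) + derive b p (1, 0) = 0].

Definition SH_L (U : set (quat R)) (f : quat R -> quat R) : Prop :=
  exists a b : R * R -> quat R, stem_cond U a b /\
    forall J p, qsphere J -> slice_dom U p ->
      f (qslice J p) = a p + qmul J (b p).

Definition SH_R (U : set (quat R)) (f : quat R -> quat R) : Prop :=
  exists a b : R * R -> quat R, stem_cond U a b /\
    forall J p, qsphere J -> slice_dom U p ->
      f (qslice J p) = a p + qmul (b p) J.

Definition qpartial (f : quat R -> quat R) (i : nat) (q : quat R) : quat R :=
  'D_(qe i) f q.

Definition qpartials_exist (f : quat R -> quat R) (q : quat R) : Prop :=
  forall i, (i < 4)%N -> derivable f q (qe i).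

Definition fueterL (f : quat R -> quat R) (q : quat R) : quat R :=
  qpartial f 0 q + qmul (qe 1) (qpartial f 1 q) + qmul (qe 2) (qpartial f 2 q)
  + qmul (qe 3) (qpartial f 3 q).

Definition fueterR (f : quat R -> quat R) (q : quat R) : quat R :=
  qpartial f 0 q + qmul (qpartial f 1 q) (qe 1) + qmul (qpartial f 2 q) (qe 2)
  + qmul (qpartial f 3 q) (qe 3).

End Quat.

(* Main.v *)
Require Import Defs.
From HB Require Import structures.
From mathcomp Require Import all_boot all_order all_algebra.
From mathcomp Require Import all_classical all_reals all_analysis.
From mathcomp Require Import ring lra.
Import Order.TTheory GRing.Theory Num.Theory.
Import numFieldNormedType.Exports.
Local Open Scope classical_set_scope.
Local Open Scope ring_scope.
Set Implicit Arguments.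
Unset Strict Implicit.

(** Write [f (u + J v) = a (u, v) + J b (u, v)]. At a point [u + e_1 v] with
    [v != 0], the partial derivatives along [e_0] and [e_1] are those of
    [a + e_1 b] within the slice, while those along [e_2] and [e_3] are
    [v^-1 e_k b]. The Cauchy-Riemann equations cancel the slice part, so that
    [D f = - (2 / v) b]. If [D f = 0] then [b = 0] off the real axis, and on it
    because [b] is odd in [v]; the Cauchy-Riemann equations then force [a] to
    be locally constant, hence so is [f q = a (Re q, |Im q|)], and
    connectedness concludes. *)

(** * Linear maps and derivatives along a direction *)

Lemma linear_fun0 (R : pzRingType) (V W : lmodType R) (L : V -> W) :
  linear L -> L 0 = 0.
Proof.
by move=> Ll; have := Ll (-1) 0 0; rewrite scaler0 addr0 scaleN1r addNr.
Qed.

Lemma linear_funZ (R : pzRingType) (V W : lmodType R) (L : V -> W) t :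
  linear L -> {morph L : x / t *: x}.
Proof.
by move=> Ll x; have := Ll t x 0; rewrite (linear_fun0 Ll) !addr0.
Qed.

Lemma linear_funD (R : pzRingType) (V W : lmodType R) (L : V -> W) :
  linear L -> {morph L : x y / x + y}.
Proof. by move=> Ll x y; have := Ll 1 x y; rewrite !scale1r. Qed.

Lemma is_derive_rV (R : realType) (V : normedModType R) n
    (w : V -> 'rV[R]_n) (x v : V) (d : 'rV[R]_n) :
  is_derive x v w d <->
  forall j, is_derive x v (fun h => w h ord0 j : R) (d ord0 j).
Proof.
split=> [[wx <-] j|wd].
  apply: DeriveDef; first by have /derivable_mxP := wx.
  by rewrite derive_mx // mxE.
have wx : derivable w x v.
  by apply/derivable_mxP => i j; rewrite ord1; have [] := wd j.
apply: DeriveDef => //; rewrite derive_mx //; apply/rowP => j; rewrite mxE.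
by have [_ ->] := wd j.
Qed.

Lemma is_derive_scale_rV (R : realType) (V : normedModType R) n (k : V -> R)
    (w : V -> 'rV[R]_n) (x v : V) (dk : R) (dw : 'rV[R]_n) :
  is_derive x v k dk -> is_derive x v w dw ->
  is_derive x v (fun h => k h *: w h) (k x *: dw + dk *: w x).
Proof.
move=> kx /is_derive_rV wx; apply/is_derive_rV => j.
have := is_deriveM kx (wx j).
rewrite !mxE [w x ord0 j *: dk]mulrC; congr is_derive.
by apply/funext => h; rewrite mxE.
Qed.

(** Expanding in the standard basis turns [L (w h)] into a finite sum of scalar coordinates times
    constant vectors, so the product rule suffices. *)
Lemma is_derive_linear_rV (R : realType) (V : normedModType R) m n
    (L : 'rV[R]_m -> 'rV[R]_n) (w : V -> 'rV[R]_m) (x v : V)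
    (dw : 'rV[R]_m) :
  linear L -> is_derive x v w dw -> is_derive x v (fun h => L (w h)) (L dw).
Proof.
move=> Ll.
have LE y : L y = \sum_j y ord0 j *: L (delta_mx ord0 j).
  rewrite {1}[y]row_sum_delta (big_morph L (linear_funD Ll) (linear_fun0 Ll)).
  by apply: eq_bigr => j _; rewrite linear_funZ.
move=> /is_derive_rV wx; rewrite LE.
have -> : (fun h => L (w h)) =
    \sum_j (fun h => w h ord0 j *: L (delta_mx ord0 j)).
  by apply/funext => h; rewrite LE fct_sumE.
apply: is_derive_sum => j.
have := is_derive_scale_rV (wx j) (is_derive_cst (L (delta_mx ord0 j)) x v).
by rewrite scaler0 add0r.
Qed.

Lemma is_derive_comp_diff (R : realType) (V W : normedModType R)
    (g : R -> V) (a : V -> W) (x : R) (dg : V) :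
  is_derive x 1 g dg -> differentiable a (g x) ->
  is_derive x 1 (a \o g) ('D_dg a (g x)).
Proof.
move=> [/derivable1_diffP gx <-] ax.
have agx : differentiable (a \o g) x by exact: differentiable_comp.
apply: DeriveDef; first exact: diff_derivable.
by rewrite !deriveE // diff_comp.
Qed.

(** The two difference quotients are the same function of [h]. This reduces the partial derivatives
    of a slice function to one-variable calculus along a line, without first proving that the
    function is differentiable. *)
Lemma is_derive_lineP (R : realType) (V W : normedModType R) (f : V -> W)
    (x v : V) (d : W) :
  is_derive x v f d <-> is_derive (0 : R) 1 (fun h : R => f (x + h *: v)) d.
Proof.
have E : (fun h : R => h^-1 *: ((f \o shift x) (h *: v) - f x)) =
  (fun h : R => h^-1 *: (((fun h : R => f (x + h *: v)) \o shift 0) (h *: 1)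
      - f (x + 0 *: v))).
  apply/funext => h /=.
  by rewrite scale0r !addr0 [h *: 1]mulr1 [x + _]addrC.
split=> -[D <-]; apply: DeriveDef.
- by move: D; rewrite /derivable E.
- by rewrite /derive E.
- by rewrite /derivable E.
- by rewrite /derive E.
Qed.

Lemma is_derive_line (R : realType) (V : normedModType R) (p v : V) (t : R) :
  is_derive t 1 (fun h : R => p + h *: v) v.
Proof.
have D : is_derive t 1 ( *:%R^~ v : R -> V) v.
  apply: DeriveDef; first exact: diff_derivable.
  by rewrite deriveE // diff_val scale1r.
by have := is_deriveD (is_derive_cst p t 1) D; rewrite add0r.
Qed.

(** Balls are convex: the segment from [p] to [y] stays where the derivative vanishes, and the mean
    value theorem applies to each coordinate along it. *)
Lemma near_constant_of_diff0 (R : realType) n (a : R * R -> 'rV[R]_n)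
    (p : R * R) :
  (\forall y \near p, differentiable a y /\ forall v, 'D_v a y = 0) ->
  \forall y \near p, a y = a p.
Proof.
move=> /nbhs_ballP[e /= e0 ae]; near=> y; apply/rowP => j.
have ye : ball p e y by near: y; exact: nbhsx_ballx.
pose g (t : R) := p + t *: (y - p).
have ge (t : R) : 0 <= t <= 1 -> ball p e (g t).
  move=> /andP[t0 t1]; move: ye; rewrite -!ball_normE /= => ye.
  rewrite /g opprD addNKr normrN normrZ ger0_norm //.
  by rewrite (le_lt_trans _ ye)// distrC ler_piMl.
have gD (t : R) : is_derive t 1 g (y - p).
  exact: is_derive_line.
have aD (t : R) : t \in `[0, 1]%R ->
    is_derive t 1 (fun t => a (g t) ord0 j : R) 0.
  rewrite in_itv /= => /ge/ae[ag da].
  have := is_derive_comp_diff (gD t) ag; rewrite da => /is_derive_rV/(_ j).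
  by rewrite mxE.
pose F (t : R) : R := a (g t) ord0 j.
have FD (t : R) : t \in `]0, 1[%R -> is_derive t 1 F 0.
  rewrite in_itv /= => /andP[t0 t1].
  by apply: aD; rewrite in_itv /= !ltW.
have Fc : {within `[0, 1], continuous F}.
  by apply: derivable_within_continuous => t /aD[].
have [t _] := MVT_segment (df := fun=> 0) ler01 FD Fc.
by rewrite mul0r /F /g scale0r addr0 scale1r (addrC p) subrK => /subr0_eq.
Unshelve. all: by end_near. Qed.

(** * Quaternion coordinates and the two multiplications *)

Lemma qcD (R : realType) (p q : quat R) i : qc (p + q) i = qc p i + qc q i.
Proof. by rewrite /qc mxE. Qed.

Lemma qcZ (R : realType) (t : R) (q : quat R) i : qc (t *: q) i = t * qc q i.
Proof. by rewrite /qc mxE. Qed.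

Lemma qc_qe (R : realType) i j : (j < 4)%N -> qc (qe R i) j = (j == i)%:R.
Proof. by move=> j4; rewrite /qc mxE inordK. Qed.

Lemma qc_qmk (R : realType) (x y z t : R) i : (i < 4)%N ->
  qc (qmk x y z t) i = [:: x; y; z; t]`_i.
Proof. by move=> i4; rewrite /qc mxE inordK. Qed.

Lemma quat_eqP (R : realType) (p q : quat R) :
  qc p 0 = qc q 0 -> qc p 1 = qc q 1 -> qc p 2 = qc q 2 -> qc p 3 = qc q 3 ->
  p = q.
Proof.
move=> e0 e1 e2 e3; apply/rowP => i; rewrite -(inord_val i).
by case: i => -[|[|[|[|]]]].
Qed.

(* Abstracting the product handles the left and right theories at once:
   the right one is the left one for the opposite multiplication. *)
Record quat_product (R : realType) (m : quat R -> quat R -> quat R) : Prop := {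
  qpr_linl : forall y, linear (m^~ y);
  qpr_linr : forall x, linear (m x);
  qpr_unit : forall i y, (0 < i < 4)%N -> m (qe R i) (m (qe R i) y) = - y }.

Lemma quat_product_qmul (R : realType) : quat_product (@qmul R).
Proof.
split=> [y t x x'|x t y y'|i y].
- by apply: quat_eqP; rewrite !(qcD, qcZ) /= /qmul !qc_qmk //= !(qcD, qcZ); ring.
- by apply: quat_eqP; rewrite !(qcD, qcZ) /= /qmul !qc_qmk //= !(qcD, qcZ); ring.
- rewrite -scaleN1r; case: i => [|[|[|[|]]]] // _;
  by apply: quat_eqP; rewrite !qcZ /qmul !qc_qmk //= !qc_qe //=; ring.
Qed.

Lemma quat_product_qmul_op (R : realType) :
  quat_product (fun x y : quat R => qmul y x).
Proof.
split=> [y t x x'|x t y y'|i y].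
- by apply: quat_eqP; rewrite !(qcD, qcZ) /= /qmul !qc_qmk //= !(qcD, qcZ); ring.
- by apply: quat_eqP; rewrite !(qcD, qcZ) /= /qmul !qc_qmk //= !(qcD, qcZ); ring.
- rewrite -scaleN1r; case: i => [|[|[|[|]]]] // _;
  by apply: quat_eqP; rewrite !qcZ /qmul !qc_qmk //= !qc_qe //=; ring.
Qed.

(** * Slice functions for an abstract product, and their derivatives along a moving slice *)

Definition slice_fun (R : realType) (m : quat R -> quat R -> quat R)
    (U : set (quat R)) (f : quat R -> quat R) (a b : R * R -> quat R) : Prop :=
  forall J p, qsphere J -> slice_dom U p -> f (qslice J p) = a p + m J (b p).

Definition fueter (R : realType) (m : quat R -> quat R -> quat R)
    (f : quat R -> quat R) (q : quat R) : quat R :=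
  qpartial f 0 q + m (qe R 1) (qpartial f 1 q) + m (qe R 2) (qpartial f 2 q)
  + m (qe R 3) (qpartial f 3 q).

Lemma qsphere_qe1 (R : realType) : qsphere (qe R 1).
Proof. by split; rewrite !qc_qe //=; ring. Qed.

(** Axial symmetry makes the slice of [e_1] representative of all others, so derivatives are
    computed only at points of that slice. *)
Lemma slice_dom_qe1 (R : realType) (U : set (quat R)) p :
  axially_symmetric U -> slice_dom U p = U (qslice (qe R 1) p).
Proof.
move=> Us; apply/propext; split=> [[J [J1 UJ]]|Up]; last first.
  by exists (qe R 1); split=> //; exact: qsphere_qe1.
by move: UJ; case: p => u v; apply: Us => //; exact: qsphere_qe1.
Qed.

(** The line in direction [e_i] is written as a planar point [g h] on the slice of a rotating unit
    [c1 h e_1 + c2 h e_k]. Along it [f] becomes a sum of products, and the values and derivatives of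
    [c1], [c2] at 0 leave three terms. *)
Lemma is_derive_slice_curve (R : realType) (m : quat R -> quat R -> quat R)
    (U : set (quat R)) (f : quat R -> quat R) (a b : R * R -> quat R)
    (p : R * R) i k (g : R -> R * R) (c1 c2 : R -> R) dg dc :
  quat_product m -> open U -> slice_fun m U f a b ->
  U (qslice (qe R 1) p) -> differentiable a p -> differentiable b p ->
  g 0 = p -> c1 0 = 1 -> c2 0 = 0 ->
  is_derive (0 : R) 1 g dg -> is_derive (0 : R) 1 c1 0 ->
  is_derive (0 : R) 1 c2 dc ->
  (forall h, qsphere (c1 h *: qe R 1 + c2 h *: qe R k)) ->
  (forall h, qslice (qe R 1) p + h *: qe R i =
             qslice (c1 h *: qe R 1 + c2 h *: qe R k) (g h)) ->
  is_derive (qslice (qe R 1) p) (qe R i) f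
    ('D_dg a p + m (qe R 1) ('D_dg b p) + dc *: m (qe R k) (b p)).
Proof.
move=> [ml mr _] Uo fab Up ap bp g0 c10 c20 gD c1D c2D Jh qh.
apply/is_derive_lineP.
have bgD : is_derive (0 : R) 1 (b \o g) ('D_dg b p).
  by rewrite -g0; apply: is_derive_comp_diff => //; rewrite g0.
have agD : is_derive (0 : R) 1 (a \o g) ('D_dg a p).
  by rewrite -g0; apply: is_derive_comp_diff => //; rewrite g0.
have mD c : is_derive (0 : R) 1 (fun h => m c (b (g h))) (m c ('D_dg b p)).
  exact: is_derive_linear_rV (mr c) bgD.
have := is_deriveD (is_deriveD agD (is_derive_scale_rV c1D (mD (qe R 1))))
  (is_derive_scale_rV c2D (mD (qe R k))).
rewrite c10 c20 scale1r !scale0r addr0 add0r g0.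
(* The slice formula for [f] is available only over [U], so the functions are compared near 0, where
   openness keeps the line inside [U]. *)
apply: near_eq_is_derive.
have lc : {for (0 : R), continuous (fun h : R => qslice (qe R 1) p + h *: qe R i)}.
  apply/differentiable_continuous/derivable1_diffP.
  by have [] := is_derive_line (qslice (qe R 1) p) (qe R i) (0 : R).
have : \forall h \near (0 : R), U (qslice (qe R 1) p + h *: qe R i).
  by apply: lc; rewrite scale0r addr0; apply: open_nbhs_nbhs.
apply: filterS => h; rewrite qh => Uh; rewrite fab //; last first.
  by exists (c1 h *: qe R 1 + c2 h *: qe R k).
have -> : m (c1 h *: qe R 1 + c2 h *: qe R k) (b (g h)) =
  c1 h *: m (qe R 1) (b (g h)) + c2 h *: m (qe R k) (b (g h)).
  by rewrite (linear_funD (ml _)) !(linear_funZ _ (ml _)).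
by rewrite addrA.
Qed.

Lemma is_derive_pair (R : realType) (V W : normedModType R) (g1 : R -> V)
    (g2 : R -> W) (x : R) d1 d2 :
  is_derive x 1 g1 d1 -> is_derive x 1 g2 d2 ->
  is_derive x 1 (fun h => (g1 h, g2 h)) (d1, d2).
Proof.
move=> [/derivable1_diffP g1x <-] [/derivable1_diffP g2x <-].
have gx : differentiable (fun h => (g1 h, g2 h)) x by exact: differentiable_pair.
apply: DeriveDef; first exact: diff_derivable.
by rewrite !deriveE // diff_pair.
Qed.

Lemma sqrt_1Dsqr_gt0 (R : realType) (x : R) : 0 < Num.sqrt (1 + x ^+ 2).
Proof. by rewrite sqrtr_gt0 ltr_wpDr // sqr_ge0. Qed.

(** The radicand is even in [h] and equals 1 at 0. With [c] the inverse of [v], this is the factor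
    by which the modulus grows in a move orthogonal to the slice. *)
Lemma is_derive_sqrt_1Dsqr (R : realType) (c : R) :
  is_derive (0 : R) 1 (fun h => Num.sqrt (1 + (c * h) ^+ 2)) 0.
Proof.
have kD : is_derive (0 : R) 1 (fun h => c * h) c.
  have := is_deriveZ c (is_derive_id (0 : R) 1).
  by rewrite [c *: 1]mulr1.
have iD : is_derive (0 : R) 1 (fun h => 1 + (c * h) ^+ 2) 0.
  have := is_deriveD (is_derive_cst (1 : R) (0 : R) 1) (is_deriveM kD kD).
  by rewrite mulr0 scale0r !addr0.
have pos : 0 < 1 + (c * 0) ^+ 2 by rewrite mulr0 expr0n addr0.
have := @is_derive1_comp _ Num.sqrt (fun h => 1 + (c * h) ^+ 2) 0 _ _
  (is_derive1_sqrt pos) iD.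
by rewrite mulr0.
Qed.

(** * The Fueter operator at a point of the slice of [e_1] *)

Section FueterSlice.
Variables (R : realType) (m : quat R -> quat R -> quat R) (U : set (quat R)).
Variables (f : quat R -> quat R) (a b : R * R -> quat R) (p : R * R).
Hypotheses (mP : quat_product m) (Uo : open U) (fab : slice_fun m U f a b).
Hypotheses (Up : U (qslice (qe R 1) p)).
Hypotheses (ap : differentiable a p) (bp : differentiable b p).

Lemma is_derive_slice_qe0 : is_derive (qslice (qe R 1) p) (qe R 0) f
  ('D_(1, 0) a p + m (qe R 1) ('D_(1, 0) b p)).
Proof.
(* Within the slice the unit stays [e_1]; the index 2 is an arbitrary choice, as its coefficient is
   0. *)
rewrite -[X in is_derive _ _ _ X]addr0.
rewrite -(scale0r (m (qe R 2) (b p))).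
apply: (@is_derive_slice_curve R m U f a b p 0 2 (fun h => p + h *: (1, 0))
  (cst 1) (cst 0)) => //.
- by rewrite scale0r addr0.
- exact: is_derive_line.
- by move=> h; rewrite scale1r scale0r addr0; exact: qsphere_qe1.
- move=> h; rewrite /qslice /= scale1r scale0r [h *: 1]mulr1 scaler0 !addr0.
  by rewrite scalerDl addrAC.
Qed.

Lemma is_derive_slice_qe1 : is_derive (qslice (qe R 1) p) (qe R 1) f
  ('D_(0, 1) a p + m (qe R 1) ('D_(0, 1) b p)).
Proof.
rewrite -[X in is_derive _ _ _ X]addr0.
rewrite -(scale0r (m (qe R 2) (b p))).
apply: (@is_derive_slice_curve R m U f a b p 1 2 (fun h => p + h *: (0, 1))
  (cst 1) (cst 0)) => //.
- by rewrite scale0r addr0.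
- exact: is_derive_line.
- by move=> h; rewrite scale1r scale0r addr0; exact: qsphere_qe1.
- move=> h; rewrite /qslice /= scale1r scale0r [h *: 1]mulr1 scaler0 !addr0.
  by rewrite scalerDl addrA.
Qed.

(* Moving orthogonally to the slice rotates the imaginary unit to first order
   and changes the modulus only to second order. *)
Lemma is_derive_slice_normal k : (1 < k < 4)%N -> p.2 != 0 ->
  is_derive (qslice (qe R 1) p) (qe R k) f (p.2^-1 *: m (qe R k) (b p)).
Proof.
move=> k4 v0; set v := p.2 in v0 *.
(* Factor [v e_1 + h e_k] as [v r(h)] times the unit [r(h)^-1 e_1 + v^-1 h r(h)^-1 e_k]. Keeping the
   sign of [v] in the first factor covers both half-planes at once. *)
pose r (h : R) := Num.sqrt (1 + (v^-1 * h) ^+ 2).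
have r0 : r 0 = 1 by rewrite /r mulr0 expr0n addr0 sqrtr1.
have r_neq0 h : r h != 0 by rewrite gt_eqF // sqrt_1Dsqr_gt0.
have rD : is_derive (0 : R) 1 r 0 by exact: is_derive_sqrt_1Dsqr.
have rVD : is_derive (0 : R) 1 (fun h => (r h)^-1) 0.
  by have := is_deriveV (r_neq0 0) rD; rewrite scaler0.
have kD : is_derive (0 : R) 1 (fun h => v^-1 * h) v^-1.
  have := is_deriveZ v^-1 (is_derive_id (0 : R) 1).
  by rewrite [v^-1 *: 1]mulr1.
(* The planar point [(p.1, v r(h))] has zero velocity at [h = 0], so [a] and [b] contribute
   derivatives in direction 0. *)
have -> : v^-1 *: m (qe R k) (b p) =
    'D_0 a p + m (qe R 1) ('D_0 b p) + v^-1 *: m (qe R k) (b p).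
  by rewrite !derive0 (linear_fun0 (qpr_linr mP _)) !add0r.
apply: (@is_derive_slice_curve R m U f a b p k k (fun h => (p.1, v * r h))
  (fun h => (r h)^-1) (fun h => v^-1 * h * (r h)^-1) 0 v^-1
  mP Uo fab Up ap bp).
- by rewrite r0 mulr1 -surjective_pairing.
- by rewrite r0 invr1.
- by rewrite mulr0 mul0r.
- apply: (@is_derive_pair _ _ _ (cst p.1) (fun h => v * r h) 0 0 0).
  by have := is_deriveZ v rD; rewrite scaler0.
- have := is_deriveM kD rVD.
  by rewrite r0 invr1 scaler0 add0r scale1r.
- move=> h.
  have e : (r h)^-1 ^+ 2 + (v^-1 * h * (r h)^-1) ^+ 2 = 1.
    have rr : r h ^+ 2 = 1 + (v^-1 * h) ^+ 2.
      by rewrite sqr_sqrtr // addr_ge0 // sqr_ge0.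
    rewrite exprMn -[X in X + _]mul1r -mulrDl -rr exprVn mulfV //.
    by rewrite expf_neq0.
  by case: k k4 => [|[|[|[|]]]] //= _; split;
    rewrite !qcD !qcZ !qc_qe //= -?[RHS]e; ring.
- move=> h; rewrite /qslice /= -/v scalerDr !scalerA addrA; congr (_ + _ *: _ + _ *: _).
    by rewrite mulfK.
  by field; rewrite v0 r_neq0.
Qed.

(** The slice directions add up to [(a_u - b_v) + e_1 (a_v + b_u)], which is 0. The factor 2 counts
    the two normal directions, each giving [v^-1 e_k (e_k b) = - v^-1 b]. *)
Lemma fueter_slice : p.2 != 0 ->
  'D_(1, 0) a p - 'D_(0, 1) b p = 0 -> 'D_(0, 1) a p + 'D_(1, 0) b p = 0 ->
  fueter m f (qslice (qe R 1) p) = - (2 / p.2) *: b p.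
Proof.
move=> v0 cr1 cr2.
rewrite /fueter /qpartial.
have [_ ->] := is_derive_slice_qe0; have [_ ->] := is_derive_slice_qe1.
have [_ ->] := is_derive_slice_normal (isT : (1 < 2 < 4)%N) v0.
have [_ ->] := is_derive_slice_normal (isT : (1 < 3 < 4)%N) v0.
rewrite (linear_funD (qpr_linr mP _)) !(linear_funZ _ (qpr_linr mP _)).
rewrite !(qpr_unit mP) //.
move/subr0_eq: cr1 => ->; move/eqP: cr2; rewrite addr_eq0 => /eqP ->.
rewrite -[- 'D_(1, 0) b p]scaleN1r (linear_funZ _ (qpr_linr mP _)) scaleN1r.
rewrite [_ + (- _ - _)]addrA addrK subrr add0r -scalerDr -opprD -mulr2n.
by rewrite -scaler_nat scalerN -scaleNr scalerA mulNr mulrC.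
Qed.

End FueterSlice.

(** * Connectedness, and polar coordinates on the quaternions *)

Lemma connected_near_constant (T : topologicalType) (S : Type) (A : set T)
    (f : T -> S) :
  open A -> connected A ->
  (forall x, A x -> \forall y \near x, f y = f x) ->
  forall x y, A x -> A y -> f x = f y.
Proof.
move=> Ao Ac fl x y Ax Ay.
(* Allowing any predicate on values gives openness of both the level set and its complement in [A],
   hence a level set that is clopen in [A]. *)
have lo (P : S -> Prop) : open [set z | A z /\ P (f z)].
  rewrite openE => z [Az Pz]; rewrite /interior /=.
  have AN : nbhs z A by exact: open_nbhs_nbhs.
  by apply: filterS2 (fl z Az) AN => w fw Aw; split => //; rewrite fw.
have : [set z | A z /\ f z = f x] = A.
  apply: Ac.
  - by exists x.
  - exists [set z | A z /\ f z = f x]; first exact: (lo (fun s => s = f x)).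
    by apply/seteqP; split=> z /= [].
  - exists (~` [set z | A z /\ f z <> f x]).
      exact/open_closedC/(lo (fun s => s <> f x)).
    apply/seteqP; split=> z /= [Az fz]; split=> //; first by case.
    by apply: contrapT => nfz; exact: fz.
by move=> /seteqP[_ /(_ _ Ay)] [_ ->].
Qed.

Lemma qslice_continuous (R : realType) (J : quat R) : continuous (qslice J).
Proof.
move=> p; rewrite /continuous_at /qslice; apply: cvgD; apply: cvgZr_tmp.
- exact: cvg_fst.
- exact: cvg_snd.
Qed.

Definition qim_norm (R : realType) (q : quat R) : R :=
  Num.sqrt (qc q 1 ^+ 2 + qc q 2 ^+ 2 + qc q 3 ^+ 2).

(** Off the real axis the unit is the normalized imaginary part; on the axis any unit works and
    [e_1] is taken. *)
Lemma qslice_polar (R : realType) (q : quat R) :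
  exists2 J, qsphere J & q = qslice J (qc q 0, qim_norm q).
Proof.
have s0 : 0 <= qc q 1 ^+ 2 + qc q 2 ^+ 2 + qc q 3 ^+ 2.
  by rewrite !addr_ge0 // sqr_ge0.
have [n0|n0] := eqVneq (qim_norm q) 0.
  exists (qe R 1); first exact: qsphere_qe1.
  move/eqP: n0; rewrite sqrtr_eq0 => n0.
  have {s0}n0 : qc q 1 ^+ 2 + qc q 2 ^+ 2 + qc q 3 ^+ 2 = 0.
    by apply/eqP; rewrite eq_le n0.
  have := sqr_ge0 (qc q 1); have := sqr_ge0 (qc q 2); have := sqr_ge0 (qc q 3).
  move=> h3 h2 h1.
  have q1 : qc q 1 = 0 by apply/eqP; rewrite -sqrf_eq0; apply/eqP; lra.
  have q2 : qc q 2 = 0 by apply/eqP; rewrite -sqrf_eq0; apply/eqP; lra.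
  have q3 : qc q 3 = 0 by apply/eqP; rewrite -sqrf_eq0; apply/eqP; lra.
  rewrite /qim_norm n0 sqrtr0.
  by apply: quat_eqP; rewrite /qslice !qcD !qcZ !qc_qe //= ?q1 ?q2 ?q3; ring.
exists ((qim_norm q)^-1 *: (q - qc q 0 *: qe R 0)); last first.
  by rewrite /qslice /= scalerA mulfV // scale1r addrC subrK.
have n2 : qim_norm q ^+ 2 = qc q 1 ^+ 2 + qc q 2 ^+ 2 + qc q 3 ^+ 2.
  by rewrite sqr_sqrtr.
split; rewrite -!scaleNr !(qcZ, qcD) !qc_qe //=; first by ring.
rewrite !mulr0 !addr0 !exprMn -!mulrDr -n2 exprVn mulVf //.
by rewrite expf_neq0.
Qed.

Lemma qc_continuous (R : realType) i : continuous (fun q : quat R => qc q i).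
Proof. by move=> q; exact: coord_continuous. Qed.

Lemma qim_norm_continuous (R : realType) : continuous (@qim_norm R).
Proof.
move=> q.
have c i : (qc q' i ^+ 2) @[q' --> q] --> qc q i ^+ 2.
  apply: (@continuous_comp _ _ _ (fun q : quat R => qc q i) (fun x => x ^+ 2)).
    exact: qc_continuous.
  exact: exprn_continuous.
apply: (@continuous_comp _ _ _
  (fun q : quat R => qc q 1 ^+ 2 + qc q 2 ^+ 2 + qc q 3 ^+ 2) Num.sqrt).
  exact: cvgD (cvgD (c 1%N) (c 2%N)) (c 3%N).
exact: sqrt_continuous.
Qed.

Lemma derive_partials (R : realType) (W : normedModType R) (a : R * R -> W)
    (p v : R * R) : differentiable a p ->
  'D_v a p = v.1 *: 'D_(1, 0) a p + v.2 *: 'D_(0, 1) a p.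
Proof.
move=> ap; rewrite !deriveE //.
have {1}-> : v = v.1 *: (1, 0) + v.2 *: (0, 1) :> R * R.
  rewrite [v in LHS]surjective_pairing; congr pair => /=.
    by rewrite [_ *: 1]mulr1 [_ *: 0]mulr0 addr0.
  by rewrite [_ *: 1]mulr1 [_ *: 0]mulr0 add0r.
by rewrite linearD !linearZ.
Qed.

(** * The kernel of the Fueter operator consists of constants *)

Section FueterKernel.
Variables (R : realType) (m : quat R -> quat R -> quat R) (U : set (quat R)).
Variables (f : quat R -> quat R) (a b : R * R -> quat R).
Hypotheses (mP : quat_product m) (Us : axially_symmetric U) (Uo : open U).
Hypotheses (ab : stem_cond U a b) (fab : slice_fun m U f a b).
Hypothesis f0 : forall q, U q -> fueter m f q = 0.

(** By axial symmetry the planar domain is the preimage of the open set [U] under the continuous map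
    [qslice (qe R 1)]. *)
Lemma near_slice_dom p : slice_dom U p -> \forall y \near p, slice_dom U y.
Proof.
have E := funext (fun y => slice_dom_qe1 y Us).
rewrite E => Up; apply: (qslice_continuous (J := qe R 1)).
exact: open_nbhs_nbhs.
Qed.

Lemma stem_imaginary_eq0 p : slice_dom U p -> b p = 0.
Proof.
move=> Up; have [[ap bp] _ bodd cr1 cr2] := ab Up.
have [v0|v0] := eqVneq p.2 0.
  (* At [v = 0] oddness reads [b p = - b p], that is [2 b p = 0]. *)
  move: bodd; rewrite v0 oppr0 -v0 -surjective_pairing => /eqP.
  rewrite -subr_eq0 opprK -mulr2n -scaler_nat scaler_eq0.
  by rewrite pnatr_eq0 /= => /eqP.
have Uq : U (qslice (qe R 1) p) by rewrite -slice_dom_qe1.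
have := fueter_slice mP Uo fab Uq ap bp v0 cr1 cr2.
rewrite f0 // => /esym/eqP; rewrite scaler_eq0 oppr_eq0 mulf_eq0 invr_eq0.
by rewrite (negPf v0) pnatr_eq0 /= => /eqP.
Qed.

Lemma near_stem_real p : slice_dom U p -> \forall y \near p, a y = a p.
Proof.
move=> /near_slice_dom Up; apply: near_constant_of_diff0.
apply: filterS Up => y Uy; have [[ay bY] _ _ cr1 cr2] := ab Uy; split=> // v.
(* [b] vanishes on a whole neighbourhood of [y], not only at [y], hence so do its derivatives; both
   partials of [a] then vanish by Cauchy-Riemann. *)
have b0 w : 'D_w b y = 0.
  rewrite -(derive_cst (0 : quat R) y w); apply: near_eq_derive.
  by apply: filterS (near_slice_dom Uy) => z /stem_imaginary_eq0.
rewrite (derive_partials v ay).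
move: cr1; rewrite b0 subr0 => ->; move: cr2; rewrite b0 addr0 => ->.
by rewrite !scaler0 addr0.
Qed.

Lemma fueter0_constant : connected U -> exists c, forall q, U q -> f q = c.
Proof.
have polar q : U q -> slice_dom U (qc q 0, qim_norm q) /\
    f q = a (qc q 0, qim_norm q).
  have [J J1 qJ] := qslice_polar q => Uq.
  have Up : slice_dom U (qc q 0, qim_norm q) by exists J; rewrite -qJ.
  split=> //; rewrite [in LHS]qJ fab // stem_imaginary_eq0 //.
  by rewrite (linear_fun0 (qpr_linr mP _)) addr0.
(* An empty [U] offers no base point; the constant 0 serves there. *)
move=> Uc; have [U0|/set0P[q0 Uq0]] := eqVneq U set0.
  by exists 0 => q; rewrite U0.
exists (f q0) => q Uq; apply: (connected_near_constant Uo Uc) => // {q0 Uq0} {}q {}Uq.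
have [Up fq] := polar _ Uq.
(* Continuity of the real part and of the imaginary modulus pulls the local constancy of [a] in the
   plane back to [f] on [U]. *)
have gc : {for q, continuous (fun q : quat R => (qc q 0, qim_norm q))}.
  exact: cvg_pair (@qc_continuous R 0 q) (@qim_norm_continuous R q).
have UN : nbhs q U by exact: open_nbhs_nbhs.
have aN : \forall y \near q,
    a (qc y 0, qim_norm y) = a (qc q 0, qim_norm q).
  exact: gc _ (near_stem_real Up).
by apply: filterS2 aN UN => y /= ay Uy; rewrite fq -ay; have [] := polar _ Uy.
Qed.

End FueterKernel.

(** * Constants are slice hyperholomorphic on both sides and lie in both kernels *)

Lemma fueter_constant (R : realType) (m : quat R -> quat R -> quat R)
    (U : set (quat R)) (f : quat R -> quat R) c :
  quat_product m -> open U -> (forall q, U q -> f q = c) ->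
  forall q, U q -> qpartials_exist f q /\ fueter m f q = 0.
Proof.
move=> mP Uo fc q Uq.
(* [f] is prescribed only on [U]; openness makes it agree with a constant near [q], so every
   directional derivative exists and is 0. *)
have D v : is_derive q v f 0.
  apply: near_eq_is_derive (is_derive_cst c q v).
  have UN : nbhs q U by exact: open_nbhs_nbhs.
  by apply: filterS UN => y /fc.
split=> [i _|]; first by have [] := D (qe R i).
have D0 i : qpartial f i q = 0 by have [] := D (qe R i).
by rewrite /fueter !D0 !(linear_fun0 (qpr_linr mP _)) !addr0.
Qed.

(** The pair [(c, 0)] is a stem for either multiplication, which lets constants pass between the
    left and right classes. *)
Lemma stem_cond_constant (R : realType) (U : set (quat R)) (c : quat R) :
  stem_cond U (cst c) (cst 0).
Proof. by move=> p _; split=> //=; rewrite ?oppr0 // !derive_cst ?subr0 ?addr0. Qed.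

Lemma slice_fun_constant (R : realType) (m : quat R -> quat R -> quat R)
    (U : set (quat R)) (f : quat R -> quat R) c :
  quat_product m -> axially_symmetric U -> (forall q, U q -> f q = c) ->
  slice_fun m U f (cst c) (cst 0).
Proof.
(* [slice_dom] supplies a point of [U] for some unit [I] only; axial symmetry moves it to [J]. *)
move=> mP Us fc J p J1 [I [I1 UI]].
rewrite /= (linear_fun0 (qpr_linr mP _)) addr0 fc //.
by case: p UI => u v; exact: Us.
Qed.

Unset Implicit Arguments.

Theorem theorem5p10 (R : realType) (Omega : set (quat R)) :
  slice_Cauchy_domain Omega -> connected Omega ->
  [/\ [set f | SH_L Omega f /\
               forall q, Omega q -> qpartials_exist f q /\ fueterL f q = 0]
      = [set f | SH_L Omega f /\ exists c : quat R, forall q, Omega q -> f q = c],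
      [set f | SH_L Omega f /\ exists c : quat R, forall q, Omega q -> f q = c]
      = [set f | SH_R Omega f /\ exists c : quat R, forall q, Omega q -> f q = c] &
      [set f | SH_R Omega f /\ exists c : quat R, forall q, Omega q -> f q = c]
      = [set f | SH_R Omega f /\
               forall q, Omega q -> qpartials_exist f q /\ fueterR f q = 0]].
Proof.
move=> [Us [Uo _]] Uc.
(* For these two products [fueter] and [slice_fun] unfold to the left and right notions, so the same
   lemmas prove both outer equalities. *)
have qL := quat_product_qmul R; have qR := quat_product_qmul_op R.
split; apply/seteqP; split=> f /=.
- move=> [fL f0]; split=> //; have [a [b [ab fab]]] := fL.
  by apply: (fueter0_constant qL Us Uo ab fab) => // q /f0[].
- move=> [fL [c fc]]; split=> // q Uq.
  exact: (fueter_constant qL Uo fc).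
- move=> [_ [c fc]]; split; last by exists c.
  exists (cst c), (cst 0); split; first exact: stem_cond_constant.
  exact: (slice_fun_constant qR Us fc).
- move=> [_ [c fc]]; split; last by exists c.
  exists (cst c), (cst 0); split; first exact: stem_cond_constant.
  exact: (slice_fun_constant qL Us fc).
- move=> [fR [c fc]]; split=> // q Uq.
  exact: (fueter_constant qR Uo fc).
- move=> [fR f0]; split=> //; have [a [b [ab fab]]] := fR.
  by apply: (fueter0_constant qR Us Uo ab fab) => // q /f0[].
Qed.
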